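(* Let $n,m\ge 1$, $I:=\{1,\dots,m\}$, and let $\Omega\subset\mathbb{R}^n$ be open and convex. For each $j\in I$ let $I_j:=\{1,\dots,\ell_j\}$ with $\ell_j$ a positive integer, and let $F:\mathbb{R}^n\to\mathbb{R}^m$, $F(x):=(f_1(x),\dots,f_m(x))$, where $f_j(x):=\max_{i\in I_j}f_{ij}(x)$ for $j\in I$ and each $f_{ij}:\mathbb{R}^n\to\mathbb{R}$ ($i\in I_j$) is continuously differentiable on $\Omega$ and continuous on the closure $\bar\Omega$. Assume that for all $j\in I$ we have $-\infty<\inf_{x\in\mathbb{R}^n}f_j(x)$, that $\mathrm{grad} f_{ij}$ is Lipschitz on $\Omega$ with constant $L_{ij}$ for each $i\in I_j$, and that for some $\bar y\in\mathbb{R}^n$ we have $S_F(F(\bar y)):=\{x\in\mathbb{R}^n: F(x)\preceq F(\bar y)\}\subset\Omega$. Let $\bar\lambda>0$ and $0<\bar\mu<1$, and take sequences $\{e^k\}\subset\mathbb{R}^m_{++}$ and $\{\lambda_k\}\subset\mathbb{R}_{++}$ satisfying $$\|e^k\|=1,\quad \bar\mu<e^k_j,\quad \frac{1}{\bar\mu}\max_{i\in I_j}L_{ij}<\lambda_k\le\bar\lambda,\qquad j\in I,\ k=0,1,\dots.$$ Let $\hat x\in S_F(F(\bar y))$. Consider the iteration with starting point $x^0=\hat x$ given by $$x^{k+1}\in \mathrm{argmin}_w\left\{F(x)+\frac{\lambda_k}{2}\|x-x^k\|^2e^k : x\in\Omega_k\right\},\qquad \Omega_k:=\{x\in\mathbb{R}^n: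 F(x)\preceq F(x^k)\},\qquad k=0,1,\dots.$$ Then: (1) the iteration is well defined, i.e. at every step $k$ the set $\mathrm{argmin}_w\{\cdots\}$ is nonempty, whatever admissible choices $x^1,\dots,x^k$ were made before; (2) any generated sequence $\{x^k\}$ is contained in $S_F(F(\bar y))$; (3) if $\Omega_k$ is convex for each $k$, then any accumulation point of a generated sequence $\{x^k\}$ is a Pareto--Clarke critical point of $F$.
   Context: $\|\cdot\|$ is the Euclidean norm. $\mathbb{R}^m_+$ and $\mathbb{R}^m_{++}$ are the sets of vectors in $\mathbb{R}^m$ with all coordinates $\ge0$, respectively $>0$. For $y,z\in\mathbb{R}^m$, $y\preceq z$ means $z-y\in\mathbb{R}^m_+$ and $y\prec z$ means $z-y\in\mathbb{R}^m_{++}$. For a nonempty set $C\subset\mathbb{R}^n$ and $G:\mathbb{R}^n\to\mathbb{R}^m$, $\mathrm{argmin}_w\{G(x):x\in C\}$ is the set of weak Pareto solutions: points $x^*\in C$ for which there is no $x\in C$ with $G(x)\prec G(x^* )$. For $f:\mathbb{R}^n\to\mathbb{R}$ locally Lipschitz at $x$ and $d\in\mathbb{R}^n$, the Clarke directional derivative is $f^\circ(x,d):=\limsup_{t\downarrow0,\ y\to x}\frac{f(y+td)-f(y)}{t}$. A point $x^*\in\mathbb{R}^n$, near which the components of $F=(f_1,\dots,f_m)$ are locally Lipschitz, is a Pareto--Clarke critical point of $F$ if for every $d\in\mathbb{R}^n$ there exists $i_0=i_0(d)\in\{1,\dots,m\}$ such that $f_{i_0}^\circ(x^*,d)\ge0$.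 *)

(* Defs.v *)
From HB Require Import structures.
From mathcomp Require Import all_boot all_order all_algebra.
From mathcomp Require Import all_classical all_reals all_analysis.

Set Implicit Arguments.
Unset Strict Implicit.
Unset Printing Implicit Defensive.

Import Order.TTheory GRing.Theory Num.Theory.
Import numFieldNormedType.Exports.

Local Open Scope classical_set_scope.
Local Open Scope ring_scope.

(* The library norm on ['rV[R]_n] is the sup norm; it induces the same topology
   (hence the same continuity and differentiability) as this one. *)
Definition enorm (R : realType) (n : nat) (x : 'rV[R]_n) : R :=
  Num.sqrt (\sum_(i < n) x 0 i ^+ 2).

Definition nneg_orthant (R : realType) (m : nat) : set 'rV[R]_m :=
  [set y | forall j, 0 <= y 0 j].

Definition pos_orthant (R : realType) (m : nat) : set 'rV[R]_m :=
  [set y | forall j, 0 < y 0 j].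

Definition preceq (R : realType) (m : nat) (y z : 'rV[R]_m) : Prop :=
  nneg_orthant (z - y).

Definition prec (R : realType) (m : nat) (y z : 'rV[R]_m) : Prop :=
  pos_orthant (z - y).

Definition sublevel (R : realType) (n m : nat)
    (F : 'rV[R]_n -> 'rV[R]_m) (a : 'rV[R]_m) : set 'rV[R]_n :=
  [set x | preceq (F x) a].

Definition argminw (R : realType) (n m : nat)
    (G : 'rV[R]_n -> 'rV[R]_m) (C : set 'rV[R]_n) : set 'rV[R]_n :=
  [set x | C x /\ ~ (exists2 z, C z & prec (G z) (G x))].

Definition coordf (R : realType) (n m : nat) (F : 'rV[R]_n -> 'rV[R]_m)
    (j : 'I_m) (x : 'rV[R]_n) : R := F x 0 j.

(* Maximum of a nonempty finite family; the default value [a ord0] of the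
   iterated operation is itself a member of the family. *)
Definition fmax (R : realType) (l : nat) (a : 'I_l.+1 -> R) : R :=
  \big[Num.max/a ord0]_(i < l.+1) a i.

(* The [j]-th index set has [(l j).+1] elements, so that it is nonempty. *)
Definition max_fun (R : realType) (n m : nat) (l : 'I_m -> nat)
    (f : forall j : 'I_m, 'I_(l j).+1 -> 'rV[R]_n -> R)
    (x : 'rV[R]_n) : 'rV[R]_m :=
  \row_(j < m) fmax (fun i => f j i x).

Definition grad (R : realType) (n : nat) (f : 'rV[R]_n -> R)
    (x : 'rV[R]_n) : 'rV[R]_n :=
  \row_(i < n) 'D_(delta_mx 0 i) f x.

Definition C1_on (R : realType) (n : nat) (Omega : set 'rV[R]_n)
    (f : 'rV[R]_n -> R) : Prop :=
  (forall x, Omega x -> differentiable f x) /\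
  {within Omega, continuous (grad f)}.

Definition elipschitz_on (R : realType) (n p : nat) (K : R)
    (A : set 'rV[R]_n) (g : 'rV[R]_n -> 'rV[R]_p) : Prop :=
  forall x y, A x -> A y -> enorm (g x - g y) <= K * enorm (x - y).

Definition locally_lipschitz_at (R : realType) (n : nat)
    (f : 'rV[R]_n -> R) (x : 'rV[R]_n) : Prop :=
  exists K : R, exists2 U : set 'rV[R]_n, nbhs x U &
    forall y z, U y -> U z -> `|f y - f z| <= K * enorm (y - z).

(* In the pair [p], [p.1] is the moving base point and [p.2] the step. *)
Definition clarke (R : realType) (n : nat) (f : 'rV[R]_n -> R)
    (x d : 'rV[R]_n) : \bar R :=
  limf_esup
    (fun p : 'rV[R]_n * R => ((f (p.1 + p.2 *: d) - f p.1) / p.2)%:E)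
    (filter_prod (nbhs x) (0 : R)^'+).

Definition pareto_clarke_critical (R : realType) (n m : nat)
    (F : 'rV[R]_n -> 'rV[R]_m) (x : 'rV[R]_n) : Prop :=
  (forall j, locally_lipschitz_at (coordf F j) x) /\
  (forall d : 'rV[R]_n, exists j : 'I_m,
     (0 <= clarke (coordf F j) x d)%E).

Definition prox_objective (R : realType) (n m : nat)
    (F : 'rV[R]_n -> 'rV[R]_m) (lam : R) (e : 'rV[R]_m)
    (c x : 'rV[R]_n) : 'rV[R]_m :=
  F x + (lam / 2 * enorm (x - c) ^+ 2) *: e.

Definition prox_step (R : realType) (n m : nat)
    (F : 'rV[R]_n -> 'rV[R]_m) (lam : R) (e : 'rV[R]_m)
    (c : 'rV[R]_n) : set 'rV[R]_n :=
  argminw (prox_objective F lam e c) (sublevel F (F c)).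

(* Only [x 0], ..., [x N] are constrained. *)
Definition prox_prefix (R : realType) (n m : nat)
    (F : 'rV[R]_n -> 'rV[R]_m) (lam : nat -> R) (e : nat -> 'rV[R]_m)
    (x0 : 'rV[R]_n) (N : nat) (x : nat -> 'rV[R]_n) : Prop :=
  x 0%N = x0 /\
  forall k, (k < N)%N -> prox_step F (lam k) (e k) (x k) (x k.+1).

Definition prox_sequence (R : realType) (n m : nat)
    (F : 'rV[R]_n -> 'rV[R]_m) (lam : nat -> R) (e : nat -> 'rV[R]_m)
    (x0 : 'rV[R]_n) (x : nat -> 'rV[R]_n) : Prop :=
  x 0%N = x0 /\ forall k, prox_step F (lam k) (e k) (x k) (x k.+1).

(* Main.v *)
Require Import Defs.
From HB Require Import structures.
From mathcomp Require Import all_boot all_order all_algebra.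
From mathcomp Require Import all_classical all_reals all_analysis.
From mathcomp Require Import ring lra.

Set Implicit Arguments.
Unset Strict Implicit.
Unset Printing Implicit Defensive.

Import Order.TTheory GRing.Theory Num.Theory.
Import numFieldNormedType.Exports.

Local Open Scope classical_set_scope.
Local Open Scope ring_scope.

(** Why the theorem holds.

  Write [G] for the objective of step [k], [c] for [x k] and [p] for [x k.+1].
  A feasible point, that is one of [sublevel F (F c)], minimizing a single
  component of [G] is a weak Pareto solution, and such a minimizer exists
  ([prox_step_nonempty]): the feasible set is closed, because its limit points lie in the closure of [Omega], where the
  pieces [f j i] are continuous ([sublevel_max_fun_closed]), and a component
  of [F] bounded below plus a positive multiple of [enorm (x - c) ^+ 2] is
  coercive.  Each step stays in a sublevel set of the previous iterate, so the
  sequence never leaves the sublevel set of [ybar].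

  Weak Pareto optimality of [p] against [c] shows that the sum of the
  components of [F] drops by at least a fixed positive multiple of
  [lambda k * enorm (p - c) ^+ 2] ([prox_step_descent]).  These sums are
  bounded below, so this quantity tends to 0, and so does
  [lambda k * enorm (p - c)] since the [lambda k] are bounded above.  Suppose
  that at an accumulation point all Clarke derivatives along [d] are negative.
  By the uniformity in the base point built into the upper limit, for small
  fixed [t] every component of [F] drops by at least [delta * t] from [p] to
  [p + t *: d], for all iterates [p] near the accumulation point
  ([clarke_lt0_decrease]).  Hence [p + t *: d] is feasible, and weak Pareto
  optimality of [p] bounds [delta] by
  [lambda k * enorm (p - c) * C + lambda k * t * enorm d ^+ 2] for a constant
  [C] ([prox_step_decrease_bound]), which is below [delta] once [t] is small
  and [k] is large.  This contradiction is [prox_cluster_clarke].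

  The accumulation point lies in [Omega], where the components of [F] are
  locally Lipschitz, as finite maxima of functions with locally bounded
  gradient ([C1_locally_lipschitz], [fmax_locally_lipschitz]). *)

(** * The Euclidean norm *)

Lemma enorm_ge0 (R : realType) (n : nat) (x : 'rV[R]_n) : 0 <= enorm x.
Proof. exact: sqrtr_ge0. Qed.

Lemma enorm_sqr (R : realType) (n : nat) (x : 'rV[R]_n) :
  enorm x ^+ 2 = \sum_(i < n) x 0 i ^+ 2.
Proof. by rewrite sqr_sqrtr// sumr_ge0// => i _; exact: sqr_ge0. Qed.

Lemma coord_le_enorm (R : realType) (n : nat) (x : 'rV[R]_n) (i : 'I_n) :
  `|x 0 i| <= enorm x.
Proof.
rewrite -sqrtr_sqr ler_wsqrtr// (bigD1 i)//= lerDl.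
by rewrite sumr_ge0// => j _; exact: sqr_ge0.
Qed.

Lemma norm_le_enorm (R : realType) (n : nat) (x : 'rV[R]_n) :
  `|x| <= enorm x.
Proof.
rewrite /Num.norm/= mx_normrE; apply: bigmax_le; first exact: enorm_ge0.
by move=> [i j] _ /=; rewrite (ord1 i); exact: coord_le_enorm.
Qed.

Lemma continuous_enorm_sqr (R : realType) (n : nat) (c : 'rV[R]_n) :
  continuous (fun x : 'rV[R]_n => enorm (x - c) ^+ 2).
Proof.
under eq_fun do rewrite enorm_sqr.
apply: continuous_big => [|i _ x]; first exact: add_continuous.
have cx : (y - c) 0 i @[y --> x] --> (x - c) 0 i.
  under eq_fun do rewrite !mxE.
  by rewrite !mxE;
    exact: (cvgB (@coord_continuous R 1 n 0 i x) (cvg_cst (c 0 i))).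
exact: (cvgM cx cx).
Qed.

(** Expansion of the squared norm along a ray, the inner product being bounded
  coordinatewise: the factor [\sum_i `|d 0 i|] stands where the
  Cauchy-Schwarz inequality would put [enorm d]. *)
Lemma enorm_sqrD_le (R : realType) (n : nat) (x d : 'rV[R]_n) (t : R) :
  0 <= t ->
  enorm (x + t *: d) ^+ 2 <=
  enorm x ^+ 2 + 2 * t * (enorm x * \sum_(i < n) `|d 0 i|)
  + t ^+ 2 * enorm d ^+ 2.
Proof.
move=> t0; rewrite !enorm_sqr !mulr_sumr -!big_split/=.
apply: ler_sum => i _; rewrite !mxE sqrrD exprMn lerD2r lerD2l.
have -> : x 0 i * (t * d 0 i) *+ 2 = 2 * t * (x 0 i * d 0 i) by ring.
rewrite ler_wpM2l ?mulr_ge0//.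
rewrite (le_trans (ler_norm _))// normrM ler_wpM2r//; exact: coord_le_enorm.
Qed.

(** * Finite maxima *)

Lemma fmax_ge (R : realType) (l : nat) (a : 'I_l.+1 -> R) (i : 'I_l.+1) :
  a i <= fmax a.
Proof. exact: le_bigmax. Qed.

Lemma fmax_le (R : realType) (l : nat) (a : 'I_l.+1 -> R) (c : R) :
  (forall i, a i <= c) -> fmax a <= c.
Proof. by move=> ac; apply: bigmax_le. Qed.

(** * Local Lipschitz continuity *)

Lemma locally_lipschitz_continuous (R : realType) (n : nat)
    (f : 'rV[R]_n -> R) (x : 'rV[R]_n) :
  locally_lipschitz_at f x -> {for x, continuous f}.
Proof.
move=> [K [U Ux fK]]; apply/(@cvgrPdist_lt _ _ _ (nbhs x) _ f (f x)) => e e0.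
have K0 : 0 < `|K| + 1 by rewrite ltr_wpDl.
have cont : (fun y : 'rV[R]_n => enorm (y - x) ^+ 2) y @[y --> x] --> (0 : R).
  have := @continuous_enorm_sqr R n x x.
  by rewrite /continuous_at subrr enorm_sqr big1// => i _; rewrite mxE expr0n.
have e2 : 0 < (e / (`|K| + 1)) ^+ 2 by rewrite exprn_gt0// divr_gt0.
have /(@cvgrPdist_lt _ _ _ (nbhs x))/(_ _ e2) small := cont.
near=> y.
have : `|0 - enorm (y - x) ^+ 2| < (e / (`|K| + 1)) ^+ 2 by near: y.
rewrite sub0r normrN ger0_norm ?sqr_ge0// ltr_pXn2r// ?nnegrE ?enorm_ge0//;
  last by rewrite divr_ge0 ?ltW.
rewrite ltr_pdivlMr// mulrC => ye.
rewrite distrC (le_lt_trans (fK y x _ _))//;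
  [by near: y|exact: nbhs_singleton|].
apply: le_lt_trans ye; rewrite ler_wpM2r ?enorm_ge0//.
by rewrite (le_trans (ler_norm _))// lerDl.
Unshelve. all: by end_near. Qed.

Lemma fmax_locally_lipschitz (R : realType) (n l : nat)
    (f : 'I_l.+1 -> 'rV[R]_n -> R) (x : 'rV[R]_n) :
  (forall i, locally_lipschitz_at (f i) x) ->
  locally_lipschitz_at (fun y => fmax (fun i => f i y)) x.
Proof.
move=> /choice[K] fK.
exists (\sum_i `|K i|).
have fK' i : exists U : set 'rV[R]_n, nbhs x U /\
    forall y z, U y -> U z -> `|f i y - f i z| <= K i * enorm (y - z).
  by have [U Ux UK] := fK i; exists U.
move/choice : fK' => [U UP].
exists [set y | forall i, U i y].
  exact: (@filter_forall _ _ U (nbhs x) _ (fun i => (UP i).1)).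
(* by symmetry, one of the two inequalities is enough *)
suff half y z : (forall i, U i y) -> (forall i, U i z) ->
    fmax (fun i => f i y) <=
    fmax (fun i => f i z) + (\sum_i `|K i|) * enorm (y - z).
  move=> y z Uy Uz; rewrite ler_distl lerBlDr half//= andbT.
  have -> : enorm (y - z) = enorm (z - y).
    by congr Num.sqrt; apply: eq_bigr => i _; rewrite !mxE -opprB sqrrN.
  exact: half.
move=> Uy Uz; apply: fmax_le => i.
apply: (@le_trans _ _ (f i z + K i * enorm (y - z))).
  by rewrite -lerBlDl (le_trans (ler_norm _))// (UP i).2.
apply: lerD; first exact: (fmax_ge (fun i => f i z)).
rewrite ler_wpM2r ?enorm_ge0//.
rewrite (le_trans (ler_norm _))// (bigD1 i)//= lerDl.
by rewrite sumr_ge0.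
Qed.

(** * Continuously differentiable functions are locally Lipschitz *)

Lemma derive_grad (R : realType) (n : nat) (f : 'rV[R]_n -> R)
    (x v : 'rV[R]_n) : differentiable f x ->
  'D_v f x = \sum_(i < n) v 0 i * grad f x 0 i.
Proof.
move=> df; rewrite deriveE// {1}(row_sum_delta v) linear_sum/=.
by apply: eq_bigr => i _; rewrite linearZ/= mxE deriveE.
Qed.

(** The mean value inequality on a ball of the sup norm; the bound [C] is on
  the coordinates of the gradient, whence the factor [n]. *)
Lemma mean_value_ball (R : realType) (n : nat) (f : 'rV[R]_n -> R)
    (x : 'rV[R]_n) (r C : R) :
  (forall y : 'rV[R]_n, ball x r y -> differentiable f y) ->
  (forall (y : 'rV[R]_n) i, ball x r y -> `|grad f y 0 i| <= C) ->
  forall y z : 'rV[R]_n, ball x r y -> ball x r z ->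
    `|f y - f z| <= (C *+ n) * enorm (y - z).
Proof.
move=> df gC y z xy xz.
set v := y - z.
(* reduction to one variable along the segment from [z] to [y] *)
pose g (t : R) := f (z + t *: v).
have seg (t : R) : 0 <= t <= 1 -> ball x r (z + t *: v).
  move=> /andP[t0 t1]; move: xy xz; rewrite -!ball_normE/= => xy xz.
  have -> : x - (z + t *: v) = (1 - t) *: (x - z) + t *: (x - y).
    by apply/rowP => i; rewrite !mxE; ring.
  rewrite (le_lt_trans (ler_normD _ _))// !normrZ !ger0_norm ?subr_ge0//.
  have [->|tn0] := eqVneq t 0; first by rewrite subr0 mul1r mul0r addr0.
  have tp : 0 < t by rewrite lt_neqAle eq_sym tn0.
  have -> : r = (1 - t) * r + t * r by ring.
  by rewrite ler_ltD// ?ltr_pM2l// ler_wpM2l ?subr_ge0// ltW.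
have gE (t : R) : (fun h : R => h^-1 *: ((g \o shift t) (h *: (1 : R)) - g t)) =
    (fun h : R => h^-1 *: ((f \o shift (z + t *: v)) (h *: v)
       - f (z + t *: v))).
  apply/funext => h; rewrite /g/=; congr (_ *: (f _ - _)).
  by apply/rowP => i; rewrite !mxE /GRing.scale/=; ring.
have dg (t : R) : 0 <= t <= 1 -> is_derive t 1 g ('D_v f (z + t *: v)).
  move=> t01; have dft := diff_derivable (v := v) (df _ (seg _ t01)).
  split; first by rewrite /derivable gE; exact: dft.
  by rewrite /derive gE.
have [t t01 ] : exists2 c : R, c \in `[0, 1]%R &
    g 1 - g 0 = 'D_v f (z + c *: v) * (1 - 0).
  apply: MVT_segment => //.
    by move=> c; rewrite in_itv/= => /andP[/ltW c0 /ltW c1]; apply: dg;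
      apply/andP.
  apply: derivable_within_continuous => c; rewrite in_itv/= => c01.
  by have [] := dg _ c01.
rewrite in_itv/= in t01.
rewrite subr0 mulr1 /g scale1r scale0r addr0 (addrC z) subrK => ->.
rewrite derive_grad; last exact/df/seg.
rewrite (le_trans (ler_norm_sum _ _ _))// -mulr_natr -mulrA mulrCA.
rewrite mulr_natl -[n in _ *+ n]card_ord -sumr_const.
apply: ler_sum => i _; rewrite normrM mulrC ler_pM//.
  by apply: gC; exact: seg.
exact: coord_le_enorm.
Qed.

Lemma C1_locally_lipschitz (R : realType) (n : nat) (Omega : set 'rV[R]_n)
    (f : 'rV[R]_n -> R) (x : 'rV[R]_n) :
  open Omega -> C1_on Omega f -> Omega x -> locally_lipschitz_at f x.
Proof.
move=> oO [df]; rewrite continuous_open_subspace// => cg Ox.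
have /(@cvgrPdist_lt _ _ _ (nbhs x))/(_ _ ltr01) gx :
    grad f y @[y --> x] --> grad f x.
  by apply: cg; rewrite inE.
have : nbhs x (Omega `&` [set y | `|grad f x - grad f y| < 1]).
  by apply: filterI => //; exact: open_nbhs_nbhs.
move=> /nbhs_ballP[r /= r0 xr].
exists ((`|grad f x| + 1) *+ n), (ball x r); first exact: nbhsx_ballx.
apply: mean_value_ball => [y /xr[/df]|y i /xr[_ /= gxy]]//.
have coord_norm (w : 'rV[R]_n) : `|w 0 i| <= `|w|.
  by rewrite /Num.norm/= mx_normrE (le_bigmax _ (fun k => `|w k.1 k.2|) (0, i)).
have -> : grad f y 0 i = grad f x 0 i - (grad f x - grad f y) 0 i.
  by rewrite !mxE; ring.
by rewrite (le_trans (ler_normB _ _))// lerD// (le_trans (coord_norm _))// ltW.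
Qed.

(** * The componentwise orders and sublevel sets *)

Lemma preceqP (R : realType) (m : nat) (y z : 'rV[R]_m) :
  preceq y z <-> forall j, y 0 j <= z 0 j.
Proof. by split=> yz j; have := yz j; rewrite !mxE subr_ge0. Qed.

Lemma precP (R : realType) (m : nat) (y z : 'rV[R]_m) :
  prec y z <-> forall j, y 0 j < z 0 j.
Proof. by split=> yz j; have := yz j; rewrite !mxE subr_gt0. Qed.

Lemma sublevel_trans (R : realType) (n m : nat)
    (F : 'rV[R]_n -> 'rV[R]_m) (a b : 'rV[R]_m) :
  preceq a b -> sublevel F a `<=` sublevel F b.
Proof.
move=> /preceqP ab x /preceqP xa; apply/preceqP => j.
exact: le_trans (xa j) (ab j).
Qed.

(** A sublevel set contained in [Omega] is closed as soon as the pieces are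
  continuous on the closure of [Omega], where its limit points lie. *)
Lemma sublevel_max_fun_closed (R : realType) (n m : nat) (l : 'I_m -> nat)
    (f : forall j : 'I_m, 'I_(l j).+1 -> 'rV[R]_n -> R)
    (Omega : set 'rV[R]_n) (a : 'rV[R]_m) :
  (forall j i, {within closure Omega, continuous (f j i)}) ->
  sublevel (max_fun f) a `<=` Omega -> closed (sublevel (max_fun f) a).
Proof.
move=> fc sO p clp; apply/preceqP => j; rewrite mxE; apply: fmax_le => i.
have Op : closure Omega p by exact: closure_subset clp.
rewrite leNgt; apply/negP => afp.
have near_gt : nbhs p [set y | closure Omega y -> a 0 j < f j i y].
  have /subspace_continuousP/(_ _ Op) fp := fc j i.
  exact: (fp [set z | a 0 j < z] (open_nbhs_nbhs (conj (@open_gt _ _) afp))).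
have [y [Sy /=]] := clp _ near_gt.
have := Sy; move=> /preceqP/(_ j); rewrite mxE leNgt => /negP + agt; apply.
exact: lt_le_trans (agt (subset_closure (sO _ Sy))) (fmax_ge (f j ^~ y) i).
Qed.

(** * Descent along a direction with negative Clarke derivative *)

(** The decrease is uniform in the base point near [x]. *)
Lemma clarke_lt0_decrease (R : realType) (n : nat) (f : 'rV[R]_n -> R)
    (x d : 'rV[R]_n) : (clarke f x d < 0)%E ->
  exists2 delta : R, 0 < delta &
    \forall p \near filter_prod (nbhs x) (0 : R)^'+,
      f (p.1 + p.2 *: d) <= f p.1 - delta * p.2.
Proof.
move=> /ereal_inf_lt[s [V VF <-] s0].
have [delta delta0 sd] : exists2 delta : R, 0 < delta &
    (ereal_sup [set ((f (p.1 + p.2 *: d) - f p.1) / p.2)%:E | p in V]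
      <= (- delta)%:E)%E.
  move: s0; case: ereal_sup => [r| |]//.
    by rewrite lte_fin => r0; exists (- r); rewrite ?oppr_gt0// opprK.
  by exists 1 => //; rewrite leNye.
exists delta => //.
have pos : \forall p \near filter_prod (nbhs x) (0 : R)^'+, 0 < p.2.
  exists (setT, [set t : R | 0 < t]) => [|[y t] []//].
  by split; [exact: filterT|exact: nbhs_right_gt].
apply: filterS (filterI VF pos) => -[y t] [Vp /= t0].
have : (((f (y + t *: d) - f y) / t)%:E <= (- delta)%:E)%E.
  by apply: le_trans sd; apply: ereal_sup_ubound; exists (y, t).
by rewrite lee_fin ler_pdivrMr// mulNr lerBlDl.
Qed.

(** * Proximal steps *)

(** The step is a minimizer over the sublevel set of the [j]-th component of the
  objective, which is coercive. *)
Lemma prox_step_nonempty (R : realType) (n m : nat)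
    (F : 'rV[R]_n -> 'rV[R]_m) (lam : R) (e : 'rV[R]_m) (c : 'rV[R]_n)
    (j : 'I_m) (b : R) :
  0 < lam -> 0 < e 0 j -> (forall x, b <= F x 0 j) ->
  closed (sublevel F (F c)) ->
  (forall x, sublevel F (F c) x -> {for x, continuous (coordf F j)}) ->
  prox_step F lam e c !=set0.
Proof.
move=> lam0 e0 bF clC Fcont.
have k0 : 0 < lam / 2 * e 0 j by rewrite mulr_gt0// divr_gt0.
pose M := (F c 0 j - b) / (lam / 2 * e 0 j).
have M0 : 0 <= M by rewrite divr_ge0 ?subr_ge0// ltW.
pose A := [set x | enorm (x - c) ^+ 2 <= M] `&` sublevel F (F c).
have Cc : sublevel F (F c) c by apply/preceqP.
have enorm0 : enorm (c - c) ^+ 2 = 0.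
  by rewrite subrr enorm_sqr big1// => i _; rewrite mxE expr0n.
have clB : closed [set x | enorm (x - c) ^+ 2 <= M].
  apply: (@preimage_closed _ _ (fun x : 'rV[R]_n => enorm (x - c) ^+ 2)
    [set y | y <= M]); last exact: closed_le.
  by move=> x _; exact: continuous_enorm_sqr.
(* outside [A] the objective exceeds its value at [c], so [A] suffices *)
have cpA : compact A.
  apply: compact_closedI => //; apply: bounded_closed_compact => //.
  exists (`|c| + (M + 1)); split; first exact: num_real.
  move=> r rM x /= xM; apply: le_trans (ltW rM).
  have -> : x = c + (x - c) by rewrite addrC subrK.
  rewrite (le_trans (ler_normD _ _))// lerD2l.
  rewrite (le_trans (norm_le_enorm _))//.
  have := enorm_ge0 (x - c); nra.
have A0 : A !=set0 by exists c; split => //=; rewrite enorm0.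
pose phi (x : 'rV[R]_n) := prox_objective F lam e c x 0 j.
have phiE x : phi x = F x 0 j + lam / 2 * e 0 j * enorm (x - c) ^+ 2.
  by rewrite /phi /prox_objective !mxE mulrAC.
have phic : {within A, continuous phi}.
  apply: continuous_in_subspaceT => x; rewrite inE => -[_ Cx].
  rewrite (_ : phi = fun x => coordf F j x
    + lam / 2 * e 0 j * enorm (x - c) ^+ 2); last exact/funext.
  exact: (cvgD (Fcont x Cx) (cvgM (cvg_cst _) (@continuous_enorm_sqr R n c x))).
have [p pA pmin] := compact_EVT_min A0 cpA phic.
move: pA; rewrite inE => -[_ Cp].
exists p; split => // -[z Cz /precP/(_ j)]; apply/negP; rewrite -leNgt.
have [zM|Mz] := leP (enorm (z - c) ^+ 2) M; first by apply: pmin; rewrite inE.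
have pc : phi p <= phi c.
  by apply: pmin; rewrite inE; split => //=; rewrite enorm0.
apply: le_trans pc _; rewrite -/(phi z) !phiE enorm0 mulr0 addr0.
move: Mz; rewrite /M ltr_pdivrMr// => Mz.
by have := bF z; lra.
Qed.

Lemma prox_step_descent (R : realType) (n m : nat)
    (F : 'rV[R]_n -> 'rV[R]_m) (lam mu : R) (e : 'rV[R]_m)
    (c p : 'rV[R]_n) :
  0 <= lam -> (forall j, mu <= e 0 j) -> prox_step F lam e c p ->
  \sum_j F p 0 j + lam / 2 * mu * enorm (p - c) ^+ 2 <= \sum_j F c 0 j.
Proof.
move=> lam0 mue [/preceqP Fpc wp].
(* the proximal term vanishes at [c] *)
have [j jP] : exists j, prox_objective F lam e c p 0 j <= F c 0 j.
  apply: contrapT => /forallNP np; apply: wp; exists c; first exact/preceqP.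
  apply/precP => j.
  have -> : prox_objective F lam e c c 0 j = F c 0 j.
    by rewrite !mxE subrr enorm_sqr big1 ?mulr0 ?mul0r ?addr0// => i _;
      rewrite mxE expr0n.
  by rewrite ltNge; apply/negP/np.
rewrite (bigD1 j)//= [leRHS](bigD1 j)//= addrAC lerD ?ler_sum//.
apply: le_trans jP; rewrite !mxE lerD2l mulrAC ler_wpM2l//.
by rewrite mulr_ge0 ?sqr_ge0// divr_ge0.
Qed.

(** If every component of [F] decreases by at least [delta * t] from [p] to
  [p + t *: d], then that point is feasible, and by weak Pareto optimality of
  [p] some component pays for the decrease with the growth of the proximal
  term. *)
Lemma prox_step_decrease_bound (R : realType) (n m : nat)
    (F : 'rV[R]_n -> 'rV[R]_m) (lam : R) (e : 'rV[R]_m)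
    (c p d : 'rV[R]_n) (delta t : R) :
  0 < lam -> (forall j, 0 < e 0 j <= 1) -> 0 < delta -> 0 < t ->
  prox_step F lam e c p ->
  (forall j, F (p + t *: d) 0 j <= F p 0 j - delta * t) ->
  delta <= lam * enorm (p - c) * (\sum_i `|d 0 i|)
           + lam * t * enorm d ^+ 2.
Proof.
move=> lam0 e01 delta0 t0 [/preceqP Fpc wp] dec.
have [j jP] : exists j, prox_objective F lam e c p 0 j <=
    prox_objective F lam e c (p + t *: d) 0 j.
  apply: contrapT => /forallNP np; apply: wp; exists (p + t *: d).
    apply/preceqP => j; rewrite (le_trans (dec j))// (le_trans _ (Fpc j))//.
    by rewrite gerBl mulr_ge0 ?ltW.
  by apply/precP => j; rewrite ltNge; apply/negP/np.
have /andP[ej0 ej1] := e01 j.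
have := enorm_sqrD_le (p - c) d (ltW t0).
rewrite (_ : p - c + t *: d = p + t *: d - c); last by rewrite addrAC.
move: jP; rewrite !mxE.
have := dec j.
set q := enorm (p + t *: d - c) ^+ 2.
set s := \sum_i _; set D := enorm d ^+ 2; set N := enorm (p - c).
move=> decj jP qle.
have N0 : 0 <= N by exact: enorm_ge0.
have s0 : 0 <= s by rewrite sumr_ge0.
have D0 : 0 <= D by exact: sqr_ge0.
have t0' := ltW t0; have lam0' := ltW lam0.
set w := 2 * t * (N * s) + t ^+ 2 * D.
have w0 : 0 <= w.
  by rewrite addr_ge0// mulr_ge0// ?sqr_ge0// mulr_ge0.
have k0 : 0 <= lam / 2 by rewrite divr_ge0.
have key : delta * t <= lam / 2 * w.
  have h1 : lam / 2 * (q - N ^+ 2) * e 0 j <= lam / 2 * w * e 0 j.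
    by rewrite ler_wpM2r ?(ltW ej0)// ler_wpM2l// /w; lra.
  have h2 : lam / 2 * w * e 0 j <= lam / 2 * w.
    by rewrite ler_piMr// mulr_ge0.
  lra.
have h3 : 0 <= t * (lam * t * D).
  by apply: mulr_ge0 => //; apply: mulr_ge0 => //; exact: mulr_ge0.
rewrite -(ler_pM2r t0) (le_trans key)// /w; lra.
Qed.

(** * Accumulation points *)

Lemma nonincreasing_gap_small (R : realType) (u : nat -> R) (b eps : R) :
  (forall k, u k.+1 <= u k) -> (forall k, b <= u k) -> 0 < eps ->
  exists N, forall k, (N <= k)%N -> u k - u k.+1 < eps.
Proof.
move=> /nonincreasing_seqP udec ub eps0.
have cu : cvgn u.
  by apply: nonincreasing_is_cvgn => //; exists b => _ [k _ <-].
have /cvgrPdist_lt/(_ _ eps0)[N _ uN] := cu.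
exists N => k Nk.
have /= := uN _ Nk.
rewrite distrC ger0_norm ?subr_ge0; last exact: nonincreasing_cvgn_ge.
apply: le_lt_trans; rewrite lerD2l lerN2.
exact: nonincreasing_cvgn_ge.
Qed.

(** The steps [x k.+1 - x k] need not tend to 0, as the [lambda k] may; only
  [lambda k * enorm (x k.+1 - x k)] does.  Hence the subsequence approaching
  [xstar] is taken among the [x k.+1], where weak Pareto optimality holds. *)
Lemma prox_cluster_clarke (R : realType) (n m : nat)
    (F : 'rV[R]_n -> 'rV[R]_m) (lambda : nat -> R) (e : nat -> 'rV[R]_m)
    (lbar mu : R) (b : 'I_m -> R) (x : nat -> 'rV[R]_n)
    (xstar d : 'rV[R]_n) :
  (forall x j, b j <= F x 0 j) ->
  (forall k, 0 < lambda k <= lbar) -> 0 < mu ->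
  (forall k j, mu <= e k 0 j <= 1) ->
  (forall k, prox_step F (lambda k) (e k) (x k) (x k.+1)) ->
  cluster (x @ \oo) xstar ->
  exists j, (0 <= clarke (coordf F j) xstar d)%E.
Proof.
move=> bF lam mu0 emu step clx; apply: contrapT => /forallNP noj.
have /choice[delta0 deltaP] : forall j, exists delta : R, 0 < delta /\
    \forall p \near filter_prod (nbhs xstar) (0 : R)^'+,
      F (p.1 + p.2 *: d) 0 j <= F p.1 0 j - delta * p.2.
  move=> j; have /negP := noj j; rewrite -ltNge => /clarke_lt0_decrease.
  by move=> [delta ? ?]; exists delta.
pose delta := \big[Num.min/1]_j delta0 j.
have delta_gt0 : 0 < delta by apply: lt_bigmin => // j _; exact: (deltaP j).1.
have delta_le j : delta <= delta0 j by exact: bigmin_le.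
have lbar0 : 0 < lbar by have /andP[l0 ll] := lam 0%N; exact: lt_le_trans ll.
set s := \sum_i `|d 0 i|; set D := enorm d ^+ 2.
have s0 : 0 <= s by rewrite sumr_ge0.
have D0 : 0 <= D by exact: sqr_ge0.
have [[U V] /= [Ux V0] UV] := @filter_forall _ _ _ _
  (filter_prod_filter (nbhs_filter xstar) _) (fun j => (deltaP j).2).
(* a step length [t] for which the quadratic term is below [delta / 2] *)
have [t [t0 Vt tD]] : exists t : R, [/\ 0 < t, V t & lbar * t * D < delta / 2].
  have tb : 0 < delta / 2 / (lbar * (D + 1)).
    by rewrite !divr_gt0// mulr_gt0// ltr_wpDl.
  have [t [[t0 Vt] tlt]] := filter_ex (filterI
    (filterI (nbhs_right_gt (0 : R)) V0) (nbhs_right_lt tb)).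
  exists t; split => //; move: tlt => /=.
  rewrite ltr_pdivlMr ?mulr_gt0 ?ltr_wpDl//.
  move=> tlt; have tl0 : 0 < t * lbar by exact: mulr_gt0.
  lra.
(* [eta * s <= delta / 2]; adding 1 to [s] covers the case [d = 0] *)
pose eta := delta / (2 * (s + 1)).
have eta0 : 0 < eta by rewrite divr_gt0// mulr_gt0// ltr_wpDl.
(* This bound on the gap forces [lambda k * enorm (x k.+1 - x k) < eta]: by
  descent, its square is at most [2 * lbar / mu] times the gap. *)
have [N gap] : exists N, forall k, (N <= k)%N ->
    \sum_j F (x k) 0 j - \sum_j F (x k.+1) 0 j < mu / (2 * lbar) * eta ^+ 2.
  apply: (@nonincreasing_gap_small _ (fun k => \sum_j F (x k) 0 j)
    (\sum_j b j)) => [k|k|].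
  - by apply: ler_sum => j _; have [/preceqP + _] := step k; exact.
  - exact: ler_sum.
  - by rewrite mulr_gt0 ?exprn_gt0// divr_gt0// mulr_gt0.
have [p [[k Nk ->] Up]] : [set y | exists2 k, (N <= k)%N & y = x k.+1] `&` U
    !=set0.
  apply: clx => //; exists N.+1 => // -[//|k] /= Nk.
  by exists k.
have /andP[l0 ll] := lam k.
have emuk j : mu <= e k 0 j by have /andP[] := emu k j.
have e01 j : 0 < e k 0 j <= 1.
  by have /andP[me ->] := emu k j; rewrite (lt_le_trans mu0 me).
have small : lambda k * enorm (x k.+1 - x k) < eta.
  have n0 := enorm_ge0 (x k.+1 - x k).
  have eta_ge0 : 0 <= eta by exact: ltW.
  rewrite -(@ltr_pXn2r _ 2)// ?nnegrE//; last by rewrite mulr_ge0// ltW.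
  have := prox_step_descent (ltW l0) emuk (step k).
  have := gap k Nk; rewrite mulrAC ltr_pdivlMr ?mulr_gt0//.
  set S := \sum_j F (x k) 0 j; set S' := \sum_j F (x k.+1) 0 j.
  rewrite (exprMn 2 (lambda k)); set Q := enorm _ ^+ 2 => gapk desc.
  have Q0 : 0 <= Q by exact: sqr_ge0.
  rewrite -(ltr_pM2l mu0); apply: le_lt_trans gapk.
  have h1 : lambda k * (lambda k * mu * Q) <= lbar * (lambda k * mu * Q).
    by rewrite ler_wpM2r// !mulr_ge0// ltW.
  have h2 : lbar * (lambda k / 2 * mu * Q) <= lbar * (S - S').
    by rewrite ler_wpM2l ?(ltW lbar0)//; lra.
  lra.
have dec j : F (x k.+1 + t *: d) 0 j <= F (x k.+1) 0 j - delta * t.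
  have /(_ j)/= Fle := UV (x k.+1, t) (conj Up Vt).
  by rewrite (le_trans Fle)// lerD2l lerN2 ler_wpM2r// ltW.
have := prox_step_decrease_bound l0 e01 delta_gt0 t0 (step k) dec.
apply/negP; rewrite -ltNge -/s -/D.
have h1 : lambda k * enorm (x k.+1 - x k) * s <= eta * s.
  by rewrite ler_wpM2r// ltW.
have h2 : eta * s <= delta / 2.
  rewrite /eta invfM mulrA -mulrA ler_piMr ?divr_ge0 ?ltW//.
  by rewrite mulrC ltr_pdivrMr ?ltr_wpDl// mul1r ltrDl.
have h3 : lambda k * t * D <= lbar * t * D.
  by rewrite ler_wpM2r// ler_wpM2r// ltW.
lra.
Qed.

(** * Convergence of the proximal iteration *)

Theorem theorem3p1 (R : realType) (n m : nat) (n_gt0 : (0 < n)%N)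
  (m_gt0 : (0 < m)%N)
  (Omega : set 'rV[R]_n) (Omega_open : open Omega)
  (Omega_convex : convex_set Omega)
  (l : 'I_m -> nat) (f : forall j : 'I_m, 'I_(l j).+1 -> 'rV[R]_n -> R)
  (f_C1 : forall j i, C1_on Omega (f j i))
  (f_cont : forall j i, {within closure Omega, continuous (f j i)})
  (F : 'rV[R]_n -> 'rV[R]_m) (F_def : F = max_fun f)
  (F_bounded : forall j : 'I_m,
     (-oo < ereal_inf (range (fun x => (coordf F j x)%:E)))%E)
  (L : forall j : 'I_m, 'I_(l j).+1 -> R)
  (grad_lip : forall j i, elipschitz_on (L j i) Omega (grad (f j i)))
  (ybar : 'rV[R]_n) (sub_Omega : sublevel F (F ybar) `<=` Omega)
  (lambdabar mubar : R) (lambdabar_gt0 : 0 < lambdabar)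
  (mubar_gt0 : 0 < mubar) (mubar_lt1 : mubar < 1)
  (e : nat -> 'rV[R]_m) (lambda : nat -> R)
  (e_pos : forall k, pos_orthant (e k))
  (lambda_gt0 : forall k, 0 < lambda k)
  (e_norm : forall k, enorm (e k) = 1)
  (e_gt : forall k j, mubar < e k 0 j)
  (lambda_gt : forall k (j : 'I_m), 1 / mubar * fmax (L j) < lambda k)
  (lambda_le : forall k, lambda k <= lambdabar)
  (xhat : 'rV[R]_n) (xhat_in : sublevel F (F ybar) xhat) :
  [/\ forall (k : nat) (x : nat -> 'rV[R]_n),
        prox_prefix F lambda e xhat k x ->
        prox_step F (lambda k) (e k) (x k) !=set0,
      forall x : nat -> 'rV[R]_n, prox_sequence F lambda e xhat x ->
        forall k, sublevel F (F ybar) (x k)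
    & forall x : nat -> 'rV[R]_n, prox_sequence F lambda e xhat x ->
        (forall k, convex_set (sublevel F (F (x k)))) ->
        forall xstar : 'rV[R]_n, cluster (x @ \oo) xstar ->
          pareto_clarke_critical F xstar].
Proof.
have fmaxE j x : coordf F j x = fmax (fun i => f j i x).
  by rewrite F_def /coordf mxE.
have lipF j x : Omega x -> locally_lipschitz_at (coordf F j) x.
  move=> Ox; rewrite (_ : coordf F j = fun y => fmax (fun i => f j i y)).
    by apply: fmax_locally_lipschitz => i; exact: C1_locally_lipschitz Ox.
  exact/funext.
have bF j : exists b : R, forall x, b <= F x 0 j.
  have := F_bounded j.
  have lb x : (ereal_inf (range (fun x => (coordf F j x)%:E))
      <= (coordf F j x)%:E)%E by apply: ereal_inf_lbound; exists x.
  case: ereal_inf lb => [r| |] lb // _;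
    last by have := lb ybar; rewrite leye_eq.
  by exists r => x; have := lb x; rewrite lee_fin.
have [b bP] := choice bF.
have clF y : preceq (F y) (F ybar) -> closed (sublevel F (F y)).
  move=> Fy; have := sub_Omega; rewrite F_def => sO.
  apply: (sublevel_max_fun_closed f_cont) => x /(sublevel_trans _) xy.
  by apply: sO; apply: xy; rewrite -F_def.
have e_le1 k j : e k 0 j <= 1.
  by rewrite -(e_norm k) (le_trans (ler_norm _))// coord_le_enorm.
have stay x N : prox_prefix F lambda e xhat N x ->
    forall k, (k <= N)%N -> sublevel F (F ybar) (x k).
  move=> [x0 step]; elim=> [|k IH] kN; first by rewrite x0.
  have [Fk _] := step k kN.
  exact: (sublevel_trans (IH (ltnW kN))).
have stay_seq x : prox_sequence F lambda e xhat x ->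
    forall k, sublevel F (F ybar) (x k).
  by move=> [x0 step] k; apply: (stay x k).
split => // [k x xp|x xs _ xstar clx].
  have xk := stay x k xp k (leqnn k).
  apply: (prox_step_nonempty (lambda_gt0 k) (e_pos k (Ordinal m_gt0))
    (bP (Ordinal m_gt0)) (clF _ xk)) => y yk.
  apply/locally_lipschitz_continuous/lipF/sub_Omega.
  exact: sublevel_trans yk.
split=> [j|d].
  apply: lipF; apply: sub_Omega.
  suff : closure (sublevel F (F ybar)) xstar.
    by apply: clF; apply/preceqP.
  move=> B xB; apply: clx => //.
  by exists 0%N => // k _; exact: stay_seq.
apply: (@prox_cluster_clarke R n m F lambda e lambdabar mubar b x) => //.
- by move=> k; rewrite lambda_gt0 lambda_le.
- by move=> k j; rewrite ltW//= e_le1.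
- by have [] := xs.
Qed.
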